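(* Let $I=(A,\succ,c)$ be an SF instance. Consider the integer linear program with binary variables $w_{ij},h_{ij},f_{ij}\in\{0,1\}$ for all $a_i,a_j\in A$, objective $\min\sum_{a_i,a_j\in A}h_{ij}$, and constraints (2) $\sum_{a_j\in A\setminus\{a_i\}}(\tfrac12h_{ij}+f_{ij})\le c_i$ for all $a_i\in A$; (3) $h_{ij}+f_{ij}\le1$ for all $a_i,a_j\in A$; (4) $h_{ij}=h_{ji}$ for all $a_i,a_j\in A$; (5) $f_{ij}=f_{ji}$ for all $a_i,a_j\in A$; (6) $f_{ij}+w_{ij}+w_{ji}\ge1$ for all distinct $a_i,a_j\in A$; (7) $\sum_{a_k:\,a_k\succeq_i a_j}(\tfrac12h_{ik}+f_{ik})\ge c_iw_{ij}$ for all $a_i,a_j\in A$; (8) $w_{ij},h_{ij},f_{ij}\in\{0,1\}$ for all $a_i,a_j\in A$. For a 0/1 assignment $\langle\mathbf w,\mathbf h,\mathbf f\rangle$ define its associated half-matching by $M^{\text{half}}=\{\{a_i,a_j\}: i\neq j,\ h_{ij}=1\}$ (pairs of weight $\tfrac12$) and $M^{\text{full}}=\{\{a_i,a_j\}: i\neq j,\ f_{ij}=1\}$ (pairs of weight $1$). Then: if $\langle\mathbf w,\mathbf h,\mathbf f\rangle$ is a feasible solution of the ILP, its associated half-matching $(M^{\text{half}},M^{\text{full}})$ is a stable half-matching of $I$; and conversely, for every stable half-matching $(M^{\text{half}},M^{\text{full}})$ of $I$ there is a feasible solution of the ILP whose associated half-matching is $(M^{\text{half}},M^{\text{full}})$.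
   Context: A Stable Fixtures (SF) instance is $I=(A,\succ,c)$ where $A=\{a_1,\dots,a_n\}$ is a finite set of $n$ agents; each agent $a_i$ has a strict linear order $\succ_i$ over $A\setminus\{a_i\}$ (complete preference list), with the convention that every agent ranks itself last ($a_j\succ_i a_i$ for all $j\neq i$); $a\succeq_i b$ means $a\succ_i b$ or $a=b$. Each agent has an integer capacity $c_i$ with $1\le c_i<n$. A half-matching is given by disjoint sets $M^{\text{half}},M^{\text{full}}$ of unordered pairs of distinct agents (weight $\tfrac12$ and $1$ respectively), equivalently a weight function $w$ on pairs with values in $\{0,\tfrac12,1\}$, such that $\sum_{j\neq i}w(\{a_i,a_j\})\le c_i$ for every $a_i$. It is stable if for every pair $e=\{a_i,a_j\}$ of distinct agents, either $w(e)=1$ or some $a_k\in e$ satisfies $\sum_{f\ni a_k,\ f\succeq_k e}w(f)=c_k$, where $a_k$ ranks pairs containing it by the rank of the other agent in $\succ_k$ (i.e., $a_k$ is filled to capacity with partners at least as good as the other agent of $e$). *)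

(* Defs.v *)
From mathcomp Require Import all_boot all_order all_algebra.

Set Implicit Arguments.
Unset Strict Implicit.
Unset Printing Implicit Defensive.

Import Order.TTheory GRing.Theory Num.Theory.
Local Open Scope ring_scope.

(* [pref i x y] reads "x >_i y".  The strict linear order of
   agent i over the other agents is extended to all of A by ranking i last, so
   [pref i] is a strict linear order on A with last element i. *)
Record sf_instance (A : finType) := SFInstance {
  pref : A -> rel A;
  cap : A -> nat;
  pref_irr : forall i, irreflexive (pref i);
  pref_trans : forall i, transitive (pref i);
  pref_total : forall i x y, x != y -> pref i x y || pref i y x;
  pref_self_last : forall i j, j != i -> pref i j i;
  cap_bounds : forall i, (1 <= cap i < #|A|)%N
}.

Section StableFixtures.
Variables (A : finType) (I : sf_instance A).
Implicit Types (i j k : A) (e f : {set A}) (Mhalf Mfull : {set {set A}}).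

Definition prefeq i x y : bool := pref I i x y || (x == y).

(* Unordered pairs of distinct agents are the subsets of A of cardinal 2. *)
Definition is_pair e : bool := #|e| == 2%N.

Definition weight Mhalf Mfull e : rat :=
  if e \in Mfull then 1 else if e \in Mhalf then 2%:R^-1 else 0.

Definition half_matching Mhalf Mfull : Prop :=
  [/\ forall e, e \in Mhalf -> is_pair e,
      forall e, e \in Mfull -> is_pair e,
      [disjoint Mhalf & Mfull] &
      forall i, \sum_(j | j != i) weight Mhalf Mfull [set i; j] <= (cap I i)%:R].

(* Agent k ranks the pairs containing it by the rank of the other agent. *)
Definition pair_prefeq k f e : bool :=
  [exists x, exists y, [&& f == [set k; x], e == [set k; y] & prefeq k x y]].

Definition stable_half_matching Mhalf Mfull : Prop :=
  half_matching Mhalf Mfull /\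
  forall e, is_pair e ->
    weight Mhalf Mfull e = 1 \/
    exists2 k, k \in e &
      \sum_(f | [&& is_pair f, k \in f & pair_prefeq k f e])
        weight Mhalf Mfull f = (cap I k)%:R.

Record ilp_assignment := ILPAssignment {
  w_ : A -> A -> rat;
  h_ : A -> A -> rat;
  f_ : A -> A -> rat
}.

Definition binary (x : rat) : Prop := x = 0 \/ x = 1.

Record ilp_feasible (s : ilp_assignment) : Prop := ILPFeasible {
  ilp_capacity : forall i,
    \sum_(j | j != i) (2%:R^-1 * h_ s i j + f_ s i j) <= (cap I i)%:R;
  ilp_disjoint : forall i j, h_ s i j + f_ s i j <= 1;
  ilp_half_sym : forall i j, h_ s i j = h_ s j i;
  ilp_full_sym : forall i j, f_ s i j = f_ s j i;
  ilp_stable : forall i j, i != j -> f_ s i j + w_ s i j + w_ s j i >= 1;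
  ilp_saturated : forall i j,
    \sum_(k | prefeq i k j) (2%:R^-1 * h_ s i k + f_ s i k)
      >= (cap I i)%:R * w_ s i j;
  ilp_binary : forall i j,
    [/\ binary (w_ s i j), binary (h_ s i j) & binary (f_ s i j)]
}.

(* To be minimised over the feasible assignments; feasibility does not refer
   to it. *)
Definition ilp_objective (s : ilp_assignment) : rat :=
  \sum_i \sum_j h_ s i j.

Definition assoc_half (s : ilp_assignment) : {set {set A}} :=
  [set e | [exists i, exists j,
     [&& i != j, h_ s i j == 1 & e == [set i; j]]]].

Definition assoc_full (s : ilp_assignment) : {set {set A}} :=
  [set e | [exists i, exists j,
     [&& i != j, f_ s i j == 1 & e == [set i; j]]]].

End StableFixtures.

(* Main.v *)
Require Import Defs.
From mathcomp Require Import all_boot all_order all_algebra.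

Set Implicit Arguments.
Unset Strict Implicit.
Unset Printing Implicit Defensive.

Import Order.TTheory GRing.Theory Num.Theory.
Local Open Scope ring_scope.

(** Under the correspondence between 0/1 variables and half-matchings, [2^-1 * h i j + f i j] is
    exactly the weight of the pair [{i, j}], and [w i j = 1] certifies that [i] is filled to
    capacity with partners at least as good as [j]. Constraint (7) gives only the lower bound on
    that load. The capacity constraint gives the matching upper bound, so the equality required by
    stability follows, and (6) says that each pair has weight 1 or a certificate at one of its ends.
    Conversely, [h] and [f] are the indicators of the two sets, and [w] marks every saturated
    position. The bridge is [sum_pair_prefeq], which turns stability's sum over pairs into the ILP's
    sum over agents. It relies on each agent ranking itself last, which keeps diagonal variables out
    of the sums. *)

Section Pairs.
Variable A : finType.
Implicit Types (i j k x y : A) (e : {set A}) (M : {set {set A}}).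

Lemma is_pair_set2 i j : is_pair [set i; j] = (i != j).
Proof. by rewrite /is_pair cards2; case: (i != j). Qed.

Lemma set2_inj k : injective (fun x => [set k; x]).
Proof.
move=> x y /= /setP E; apply/eqP.
have := E x; have := E y; rewrite !inE !eqxx !orbT.
move=> /orP[/eqP-> | /eqP->]; last by rewrite eqxx.
by rewrite orbb.
Qed.

(** A pair determines its two elements only up to order, and symmetry of [p] absorbs that ambiguity.
    Here [p] will be [h = 1] or [f = 1], symmetric by (4) and (5). *)
Lemma mem_sym_pairs (p : A -> A -> bool) i j :
    (forall x y, p x y = p y x) -> i != j ->
  ([set i; j] \in [set e | [exists x, exists y,
     [&& x != y, p x y & e == [set x; y]]]]) = p i j.
Proof.
move=> p_sym neq_ij; rewrite inE.
apply/existsP/idP => [[x /existsP[y /and3P[_ pxy /eqP Eij]]] | pij].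
  have: i \in [set x; y] by rewrite -Eij set21.
  rewrite !inE => /orP[] /eqP ix; subst i; first by rewrite (set2_inj Eij).
  by move: Eij; rewrite (setUC [set x]) => /set2_inj->; rewrite p_sym.
by exists i; apply/existsP; exists j; rewrite neq_ij pij eqxx.
Qed.

(** Ensures that the half-matching associated with indicator variables is the one they came from. *)
Lemma sym_pairsK M :
    (forall e, e \in M -> is_pair e) ->
  [set e | [exists x, exists y,
     [&& x != y, [set x; y] \in M & e == [set x; y]]]] = M.
Proof.
move=> pairM; apply/setP=> e; rewrite inE.
apply/existsP/idP => [[x /existsP[y /and3P[_ Mxy /eqP->]]] // | Me].
have /cards2P[x [y [neq_xy defe]]] := pairM e Me.
by exists x; apply/existsP; exists y; rewrite neq_xy -defe Me eqxx.
Qed.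

End Pairs.

Section Correctness.
Variables (A : finType) (I : sf_instance A).
Implicit Types (i j k : A) (Mhalf Mfull : {set {set A}}).

(** If [k] were [i], then [i] would be at least as good as [j] for itself, although it ranks itself
    last. *)
Lemma prefeq_neq i j k : j != i -> prefeq I i k j -> k != i.
Proof.
move=> neq_ji; apply: contraTneq => ->; rewrite negb_or eq_sym neq_ji andbT.
apply/negP => /(pref_trans (pref_self_last I neq_ji)).
by rewrite pref_irr.
Qed.

(** Reindexing along the injection sending [k] to [{i, k}]; [prefeq_neq] guarantees that its values
    are genuine pairs. *)
Lemma sum_pair_prefeq i j (F : {set A} -> rat) : j != i ->
  \sum_(f | [&& is_pair f, i \in f & pair_prefeq I i f [set i; j]]) F f
  = \sum_(k | prefeq I i k j) F [set i; k].
Proof.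
move=> neq_ji.
transitivity (\sum_(f in [set [set i; k] | k in prefeq I i ^~ j]) F f).
  apply: eq_bigl => f; apply/and3P/imsetP => [[_ _] | [k Pk ->]].
    case/existsP=> x /existsP[y /and3P[/eqP-> /eqP/set2_inj<- Pxj]].
    by exists x.
  rewrite is_pair_set2 eq_sym (prefeq_neq neq_ji Pk) set21; split=> //.
  by apply/existsP; exists k; apply/existsP; exists j; rewrite !eqxx.
by rewrite big_imset //= => x y _ _ /set2_inj.
Qed.

Lemma weight_ge0 Mhalf Mfull (e : {set A}) : 0 <= weight Mhalf Mfull e.
Proof. by rewrite /weight; do 2?case: ifP. Qed.

Lemma weight_disjoint Mhalf Mfull (e : {set A}) : [disjoint Mhalf & Mfull] ->
  weight Mhalf Mfull e = 2%:R^-1 * (e \in Mhalf)%:R + (e \in Mfull)%:R.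
Proof.
move=> dis; rewrite /weight; case: ifP => [Mfe | _].
  by rewrite (disjointFl dis Mfe) mulr0 add0r.
by case: ifP; rewrite ?mulr1 ?mulr0 addr0.
Qed.

Lemma binaryE (x : rat) : binary x -> x = (x == 1)%:R.
Proof. by case=> ->. Qed.

Lemma binary_bool (b : bool) : binary (b%:R : rat).
Proof. by case: b; [right | left]. Qed.

Lemma feasible_stable (s : ilp_assignment A) :
  ilp_feasible I s -> stable_half_matching I (assoc_half s) (assoc_full s).
Proof.
case=> capE disE hsym fsym stabE satE binE.
have hE i j : i != j -> ([set i; j] \in assoc_half s) = (h_ s i j == 1).
  by apply: (mem_sym_pairs (p := fun x y => h_ s x y == 1)) => x y; rewrite hsym.
have fE i j : i != j -> ([set i; j] \in assoc_full s) = (f_ s i j == 1).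
  by apply: (mem_sym_pairs (p := fun x y => f_ s x y == 1)) => x y; rewrite fsym.
have pair_half e : e \in assoc_half s -> is_pair e.
  rewrite inE => /existsP[i /existsP[j /and3P[neq_ij _ /eqP->]]].
  by rewrite is_pair_set2.
have pair_full e : e \in assoc_full s -> is_pair e.
  rewrite inE => /existsP[i /existsP[j /and3P[neq_ij _ /eqP->]]].
  by rewrite is_pair_set2.
have dis : [disjoint assoc_half s & assoc_full s].
  rewrite disjoint_subset; apply/subsetP => e he; rewrite inE.
  have /cards2P[i [j [neq_ij defe]]] := pair_half _ he.
  move: he; rewrite defe hE // fE // => /eqP hij; apply/eqP => fij.
  by have := disE i j; rewrite hij fij.
have wE i j : j != i ->
    weight (assoc_half s) (assoc_full s) [set i; j]
    = 2%:R^-1 * h_ s i j + f_ s i j.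
  rewrite eq_sym => neq_ij; rewrite weight_disjoint // hE // fE //.
  by have [_ /binaryE<- /binaryE<-] := binE i j.
have capW i :
    \sum_(j | j != i) weight (assoc_half s) (assoc_full s) [set i; j]
    <= (cap I i)%:R.
  by under eq_bigr => j neq_ji do rewrite wE //; apply: capE.
have saturated i j : j != i -> w_ s i j = 1 ->
    \sum_(f | [&& is_pair f, i \in f & pair_prefeq I i f [set i; j]])
      weight (assoc_half s) (assoc_full s) f = (cap I i)%:R.
  (* Constraint (7) bounds the load below by the capacity. For the upper bound, the load is a
     partial sum of the nonnegative weights around [i], whose total is at most the capacity. *)
  move=> neq_ji wij; rewrite sum_pair_prefeq //; apply/eqP.
  rewrite eq_le; apply/andP; split; last first.
    have := satE i j; rewrite wij mulr1 => /le_trans; apply.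
    by apply: ler_sum => k /(prefeq_neq neq_ji)/wE->.
  apply: le_trans (capW i); rewrite [leRHS](bigID (prefeq I i ^~ j)) /=.
  rewrite (eq_bigl (fun k => (k != i) && prefeq I i k j)) => [|k].
    by rewrite lerDl sumr_ge0 // => k _; apply: weight_ge0.
  by rewrite andbC; case Pk: prefeq => //=; rewrite (prefeq_neq neq_ji Pk).
split=> // e /cards2P[i [j [neq_ij ->]]].
have [_ _ [fij | fij]] := binE i j; last first.
  by left; rewrite /weight fE // fij eqxx.
right; have [[wij | wij] _ _] := binE i j; last first.
  by exists i; rewrite ?set21 // saturated // eq_sym.
have [[wji | wji] _ _] := binE j i; last first.
  by exists j; rewrite ?set22 // setUC saturated.
(* With all three variables zero, (6) would read [1 <= 0]. *)
by have := stabE i j neq_ij; rewrite fij wij wji.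
Qed.

Lemma stable_feasible Mhalf Mfull :
    stable_half_matching I Mhalf Mfull ->
  exists s : ilp_assignment A,
    [/\ ilp_feasible I s, assoc_half s = Mhalf & assoc_full s = Mfull].
Proof.
case=> -[pair_half pair_full dis capM] stabM.
pose h i j : rat := ([set i; j] \in Mhalf)%:R.
pose f i j : rat := ([set i; j] \in Mfull)%:R.
pose load i j : rat := \sum_(k | prefeq I i k j) (2%:R^-1 * h i k + f i k).
(* [w i j] is taken as large as (7) allows, so that (7) holds by construction
   and stability yields (6). *)
pose w i j : rat := ((cap I i)%:R <= load i j)%R%:R.
have wE i j : 2%:R^-1 * h i j + f i j = weight Mhalf Mfull [set i; j].
  by rewrite weight_disjoint.
have eq1 (b : bool) : ((b%:R : rat) == 1) = b by case: b.
exists (ILPAssignment w h f); split.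
- split=> /=.
  + by move=> i; under eq_bigr => j _ do rewrite wE; apply: capM.
  + move=> i j; rewrite /h /f; case Hh: (_ \in Mhalf).
      by rewrite (disjointFr dis Hh).
    by case: (_ \in Mfull).
  + by move=> i j; rewrite /h setUC.
  + by move=> i j; rewrite /f setUC.
  + move=> i j neq_ij.
    have w1 x y : y != x ->
        \sum_(e | [&& is_pair e, x \in e & pair_prefeq I x e [set x; y]])
          weight Mhalf Mfull e = (cap I x)%:R -> w x y = 1.
      move=> neq_yx; rewrite sum_pair_prefeq // /w => <-.
      by rewrite /load (eq_bigr _ (fun k _ => wE x k)) lexx.
    have b0 (b : bool) : 0 <= b%:R :> rat by exact: ler0n.
    have: is_pair [set i; j] by rewrite is_pair_set2.
    (* Each alternative of stability sets one of the three terms of (6) to 1: [f i j] for weight 1,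
       otherwise the [w] of the saturated end. The other two terms are nonnegative. *)
    case/stabM=> [wt1 | [k]].
      have -> : f i j = 1.
        by move: wt1; rewrite /f /weight; case: ifP => // _; case: ifP.
      by rewrite -addrA lerDl addr_ge0 ?b0.
    rewrite !inE => /orP[] /eqP->.
      move/w1->; last by rewrite eq_sym.
      by rewrite addrAC lerDr addr_ge0 ?b0.
    rewrite setUC => /w1->//.
    by rewrite lerDr addr_ge0 ?b0.
  (* When the load falls short of the capacity, [w i j = 0] and (7) only asks that the load be
     nonnegative. *)
  + move=> i j; rewrite -/(load i j) /w; case: (leP (cap I i)%:R (load i j)) => [|_];
    rewrite ?mulr1 //.
    rewrite mulr0 sumr_ge0 // => k _; rewrite wE; exact: weight_ge0.
  + by move=> i j; split; apply: binary_bool.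
- rewrite -[RHS]sym_pairsK //; apply/setP => e; rewrite !inE /=.
  by apply: eq_existsb => i; apply: eq_existsb => j; rewrite eq1.
- rewrite -[RHS]sym_pairsK //; apply/setP => e; rewrite !inE /=.
  by apply: eq_existsb => i; apply: eq_existsb => j; rewrite eq1.
Qed.

End Correctness.

Theorem theorem15 (A : finType) (I : sf_instance A) :
  (forall s : ilp_assignment A,
     ilp_feasible I s ->
     stable_half_matching I (assoc_half s) (assoc_full s)) /\
  (forall Mhalf Mfull : {set {set A}},
     stable_half_matching I Mhalf Mfull ->
     exists s : ilp_assignment A,
       [/\ ilp_feasible I s, assoc_half s = Mhalf & assoc_full s = Mfull]).
Proof. by split; [exact: feasible_stable | exact: stable_feasible]. Qed.
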